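(* Let $n\ge 2$ and $N\ge 2$ be integers and let $s$ be a real number. (i) If $2\le N\le n+1$ and $s\in\left[-\frac1{N-1},-\frac1n\right]$, then $E_L(n,N,s)\le -\tau^{(1)}(n,N,s)$, where $$\tau^{(1)}(n,N,s)=N(N-1)\sqrt{2(1-s)}.$$ (ii) If $n+1\le N\le 2n$ and $s\in\left[\frac{N-2n}{n(N-2)},0\right]$, then $E_L(n,N,s)\le -\tau^{(2)}(n,N,s)$, where $$\tau^{(2)}(n,N,s)=\frac{N\left(2N(1-ns^2)-2n(1-s^2)+N(n-1)\sqrt{2(1-s)}\right)}{n(1-s^2)}.$$ (iii) If $2n\le N\le n(n+3)/2$ and $$s\in\left[\frac{\sqrt{n^2(n-1)^2+4n(N-n-1)(N-2n)}-n(n-1)}{2n(N-n-1)},\ \frac{\sqrt{n+3}-1}{n+2}\right],$$ then $E_L(n,N,s)\le -\tau^{(3)}(n,N,s)$, where $$\tau^{(3)}(n,N,s)=\frac{N\left[2N(1+2s+ns^2)C_4\sqrt{A_6}-A_5\left((1-s)(1+ns)A_4+B_4\sqrt{(1-s)B_5}\right)\right]}{n(1-s)(1+2s+ns^2)^2C_4\sqrt{2B_5}}$$ and $$\begin{aligned} A_2&=(1+ns)^5(1-s)+(n-1)^2((n+1)s+2),\\ B_2&=(n-1)\sqrt{(1-s)(1+ns)((n+1)s+2)},\\ A_4&=n(n+2)(n+3)s^4+2(3n^2+13n+8)s^3+2(n^2+12n+23)s^2+2(2n^2+5n+17)s+9n+3,\\ B_4&=2(n-1)((n+1)s+2)((n-2)s^2-2ns-1),\\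 C_4&=2n(n+2)s^3-(n^2-5n-2)s^2-6ns-n-5,\\ A_5&=N(1-ns^2)-n(1-s)((n+1)s+2),\\ B_5&=\frac{(n+1)s+2}{1+ns},\\ A_6&=\frac{(1-s)\left(A_2+2(1+ns)^2B_2\right)}{1+ns}. \end{aligned}$$
   Context: $S^{n-1}$ is the unit sphere in $\mathbb{R}^n$, and $x\cdot y$ is the standard inner product. For $t\in[-1,1]$ put $L(t)=-\sqrt{2(1-t)}$, so that $L(x\cdot y)=-\|x-y\|$ for $x,y\in S^{n-1}$. For a set $\mathcal{C}=\{z_1,\dots,z_N\}\subset S^{n-1}$ of $N$ distinct points, define $E_L(\mathcal{C})=\sum_{i,j=1}^N L(z_i\cdot z_j)=-\sum_{i,j=1}^N\|z_i-z_j\|$ (sum over all ordered pairs). For $s\in[-1,1)$ define $$E_L(n,N,s)=\sup\{E_L(\mathcal{C}):\ \mathcal{C}\subset S^{n-1},\ |\mathcal{C}|=N,\ x\cdot y\le s\text{ for all distinct }x,y\in\mathcal{C}\},$$ with the convention $\sup\emptyset=-\infty$. Thus the claims are lower bounds on the sum of pairwise distances of every $N$-point code in $S^{n-1}$ whose distinct points have inner product at most $s$. *)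

(* Defs.v *)
From HB Require Import structures.
From mathcomp Require Import all_boot all_order all_algebra finmap.
From mathcomp Require Import all_classical all_reals all_analysis.
From mathcomp Require Import ring.

Set Implicit Arguments.
Unset Strict Implicit.
Unset Printing Implicit Defensive.

Import Order.TTheory GRing.Theory Num.Theory.
Local Open Scope classical_set_scope.
Local Open Scope ring_scope.

Definition dot (R : realType) (n : nat) (x y : 'rV[R]_n) : R :=
  \sum_(i < n) x 0 i * y 0 i.

(* The library norm on 'rV[R]_n is the sup norm, hence this separate
   Euclidean norm. *)
Definition enorm (R : realType) (n : nat) (x : 'rV[R]_n) : R :=
  Num.sqrt (dot x x).

(* S^(n-1) inside R^n *)
Definition usphere (R : realType) (n : nat) : set 'rV[R]_n :=
  [set x | enorm x = 1].

Definition L (R : realType) (t : R) : R := - Num.sqrt (2 * (1 - t)).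

Definition energyL (R : realType) (n : nat) (C : {fset 'rV[R]_n}) : R :=
  \sum_(x <- C) \sum_(y <- C) L (dot x y).

Definition spherical_code (R : realType) (n N : nat) (s : R) :
    set {fset 'rV[R]_n} :=
  [set C : {fset 'rV[R]_n} | [/\ [set` C] `<=` @usphere R n,
               #|` C| = N &
               forall x y, x \in C -> y \in C -> x != y -> dot x y <= s]].

(* ereal_sup set0 = -oo *)
Definition sup_energyL (R : realType) (n N : nat) (s : R) : \bar R :=
  ereal_sup [set (energyL C)%:E | C in @spherical_code R n N s].

Definition tau1 (R : realType) (n N s : R) : R :=
  N * (N - 1) * Num.sqrt (2 * (1 - s)).

Definition tau2 (R : realType) (n N s : R) : R :=
  N * (2 * N * (1 - n * s ^+ 2) - 2 * n * (1 - s ^+ 2)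
       + N * (n - 1) * Num.sqrt (2 * (1 - s)))
  / (n * (1 - s ^+ 2)).

Definition coefA2 (R : realType) (n s : R) : R :=
  (1 + n * s) ^+ 5 * (1 - s) + (n - 1) ^+ 2 * ((n + 1) * s + 2).

Definition coefB2 (R : realType) (n s : R) : R :=
  (n - 1) * Num.sqrt ((1 - s) * (1 + n * s) * ((n + 1) * s + 2)).

Definition coefA4 (R : realType) (n s : R) : R :=
  n * (n + 2) * (n + 3) * s ^+ 4
  + 2 * (3 * n ^+ 2 + 13 * n + 8) * s ^+ 3
  + 2 * (n ^+ 2 + 12 * n + 23) * s ^+ 2
  + 2 * (2 * n ^+ 2 + 5 * n + 17) * s
  + 9 * n + 3.

Definition coefB4 (R : realType) (n s : R) : R :=
  2 * (n - 1) * ((n + 1) * s + 2) * ((n - 2) * s ^+ 2 - 2 * n * s - 1).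

Definition coefC4 (R : realType) (n s : R) : R :=
  2 * n * (n + 2) * s ^+ 3 - (n ^+ 2 - 5 * n - 2) * s ^+ 2
  - 6 * n * s - n - 5.

Definition coefA5 (R : realType) (n N s : R) : R :=
  N * (1 - n * s ^+ 2) - n * (1 - s) * ((n + 1) * s + 2).

Definition coefB5 (R : realType) (n s : R) : R :=
  ((n + 1) * s + 2) / (1 + n * s).

Definition coefA6 (R : realType) (n s : R) : R :=
  (1 - s) * (coefA2 n s + 2 * (1 + n * s) ^+ 2 * coefB2 n s) / (1 + n * s).

Definition tau3 (R : realType) (n N s : R) : R :=
  N * (2 * N * (1 + 2 * s + n * s ^+ 2) * coefC4 n s * Num.sqrt (coefA6 n s)
       - coefA5 n N s
         * ((1 - s) * (1 + n * s) * coefA4 n s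
            + coefB4 n s * Num.sqrt ((1 - s) * coefB5 n s)))
  / (n * (1 - s) * (1 + 2 * s + n * s ^+ 2) ^+ 2 * coefC4 n s
     * Num.sqrt (2 * coefB5 n s)).

Lemma L_dot (R : realType) (n : nat) (x y : 'rV[R]_n) :
  usphere x -> usphere y -> L (dot x y) = - enorm (x - y).
Proof.
have dot1 z : @usphere R n z -> dot z z = 1.
  move=> z1; rewrite -[LHS]sqr_sqrtr ?[Num.sqrt _]z1 ?expr1n//.
  by apply: sumr_ge0 => i _; rewrite -expr2 sqr_ge0.
move=> /dot1 x1 /dot1 y1; congr (- Num.sqrt _).
suff -> : dot (x - y) (x - y) = dot x x + dot y y - 2 * dot x y.
  by rewrite x1 y1 mulrBr mulr1.
rewrite /dot mulr_sumr -sumrN -!big_split/=; apply: eq_bigr => i _.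
by rewrite !mxE; ring.
Qed.

(* Main.v *)
(* Write [h] for a polynomial with [L <= h] on [[-1, s]].  If [h] has
   nonpositive Gegenbauer coefficients in positive degrees, then summing
   [h (x . y)] over all pairs, diagonal included, gives
   [E_L <= N^2 h_0 - N h(1)].
   (i) [h] is the constant [L s].
   (ii) [h = c - lam t^2], meeting [L] at [-1] and [s].
   (iii) [h = g - lam (t - alpha)^2 (t - s)], where
   [alpha = - (1 + s) / (1 + n s)] is the double root of the third Levenshtein
   polynomial, [g] is the quadratic Hermite interpolant of [L] at
   [alpha, alpha, s], and [lam] cancels the linear Gegenbauer coefficient
   of [h].  With [a = sqrt (1 - alpha)] and [b = sqrt (1 - s)] one has
   [B5 = a^2] and [sqrt A6 = b ((1 + n s)^2 b + (n - 1) a)], which makes the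
   value of the bound an explicit rational expression in [n], [N], [s]
   and [a b], up to the factor [1 / (sqrt 2 a)]. *)
Require Import Defs.
From HB Require Import structures.
From mathcomp Require Import all_boot all_order all_algebra finmap.
From mathcomp Require Import all_classical all_reals all_analysis.
From mathcomp Require Import ring lra.

Import Order.TTheory GRing.Theory Num.Theory.
Local Open Scope ring_scope.

(** * Moment inequalities from harmonic kernels of degrees two and three *)

Section Moments.
Variables (R : realType) (n : nat).
Implicit Types (x y : 'rV[R]_n) (X : seq 'rV[R]_n).

Lemma dot_ge0 x : 0 <= dot x x.
Proof. by apply: sumr_ge0 => i _; rewrite -expr2 sqr_ge0. Qed.

Lemma usphere_dot x : usphere x -> dot x x = 1.
Proof.
by move=> x1; rewrite -[LHS]sqr_sqrtr ?dot_ge0// [Num.sqrt _]x1 expr1n.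
Qed.

Lemma dot_geN1 x y : usphere x -> usphere y -> -1 <= dot x y.
Proof.
move=> /usphere_dot x1 /usphere_dot y1.
have : 0 <= \sum_(i < n) (x 0 i + y 0 i) ^+ 2.
  by apply: sumr_ge0 => i _; rewrite sqr_ge0.
suff -> : \sum_(i < n) (x 0 i + y 0 i) ^+ 2 = dot x x + dot y y + 2 * dot x y.
  by rewrite x1 y1; lra.
rewrite /dot mulr_sumr -!big_split/=; apply: eq_bigr => i _; ring.
Qed.

(** A feature map makes the kernel positive semidefinite: exchanging sums leaves the squares of
    [\sum_(x <- X) F x i]. *)
Lemma sum_kernel_ge0 (I : finType) (F : 'rV[R]_n -> I -> R) X :
  0 <= \sum_(x <- X) \sum_(y <- X) \sum_i F x i * F y i.
Proof.
suff -> : \sum_(x <- X) \sum_(y <- X) \sum_i F x i * F y i =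
          \sum_i (\sum_(x <- X) F x i) ^+ 2.
  by apply: sumr_ge0 => i _; rewrite sqr_ge0.
under eq_bigr do rewrite exchange_big/=.
rewrite exchange_big/=; apply: eq_bigr => i _.
by rewrite expr2 big_distrlr.
Qed.

Lemma sum_delta (i : 'I_n) (f : 'I_n -> R) :
  \sum_j (i == j)%:R * f j = f i.
Proof.
rewrite (bigD1 i)//= eqxx mul1r big1 ?addr0// => j /negPf.
by rewrite eq_sym => ->; rewrite mul0r.
Qed.

(** The features are the entries of the traceless part of [x^T x]; their pairing is the degree-two
    Gegenbauer polynomial up to scale. *)
Lemma sum2_kernel x y : (0 < n)%N -> usphere x -> usphere y ->
  \sum_(p : 'I_n * 'I_n) (x 0 p.1 * x 0 p.2 - (p.1 == p.2)%:R / n%:R)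
    * (y 0 p.1 * y 0 p.2 - (p.1 == p.2)%:R / n%:R) = dot x y ^+ 2 - n%:R^-1.
Proof.
move=> n0 /usphere_dot x1 /usphere_dot y1.
rewrite -(pair_bigA _ (fun i j => (x 0 i * x 0 j - (i == j)%:R / n%:R)
    * (y 0 i * y 0 j - (i == j)%:R / n%:R)))/=.
have n0R : n%:R != 0 :> R by rewrite pnatr_eq0 -lt0n.
transitivity (\sum_i (x 0 i * y 0 i * dot x y
   - (x 0 i * x 0 i + y 0 i * y 0 i - n%:R^-1) / n%:R)).
  apply: eq_bigr => i _.
  (* [g] collects the terms with a Kronecker delta. In the term with a squared delta one factor
     stays inside, so that [sum_delta] can consume the other. *)
  pose g j := - (x 0 i * x 0 j + y 0 i * y 0 j - (i == j)%:R / n%:R) / n%:R.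
  transitivity (\sum_j (x 0 i * y 0 i * (x 0 j * y 0 j) + (i == j)%:R * g j)).
    by apply: eq_bigr => j _; rewrite /g; field.
  by rewrite big_split/= sum_delta -mulr_sumr -/(dot x y) /g eqxx mulr1n; field.
rewrite big_split/= -mulr_suml -/(dot x y) sumrN -mulr_suml !big_split/=.
rewrite -/(dot x x) -/(dot y y) x1 y1 sumr_const card_ord -mulr_natr; field.
exact: n0R.
Qed.

Let tprod (T U : 'I_n -> 'I_n -> 'I_n -> R) : R :=
  \sum_i \sum_j \sum_k T i j k * U i j k.

Let cube x i j k : R := x 0 i * x 0 j * x 0 k.
(** The identity matrix in two slots and [x] in the third: the three trace corrections to
    [cube x]. *)
Let tr12 x (i j k : 'I_n) : R := (i == j)%:R * x 0 k.
Let tr13 x (i j k : 'I_n) : R := (i == k)%:R * x 0 j.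
Let tr23 x (i j k : 'I_n) : R := (j == k)%:R * x 0 i.

Let sum_cst (a : R) : n%:R * a = \sum_(i < n) a.
Proof. by rewrite sumr_const card_ord mulr_natl. Qed.

Let tprod_cube x y : tprod (cube x) (cube y) = dot x y ^+ 3.
Proof.
rewrite 2!exprS expr1 /tprod /cube {1}/dot mulr_suml.
apply: eq_bigr => i _; rewrite {1}/dot mulr_suml mulr_sumr.
apply: eq_bigr => j _; rewrite /dot !mulr_sumr.
by apply: eq_bigr => k _; ring.
Qed.

Let tprod_cube12 x y : tprod (cube x) (tr12 y) = dot x x * dot x y.
Proof.
rewrite {1}/dot mulr_suml; apply: eq_bigr => i _.
transitivity (\sum_j (i == j)%:R * (x 0 i * x 0 j * dot x y)).
  apply: eq_bigr => j _; rewrite /dot !mulr_sumr; apply: eq_bigr => k _.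
  by rewrite /cube /tr12; ring.
exact: sum_delta.
Qed.

Let tprod_cube13 x y : tprod (cube x) (tr13 y) = dot x x * dot x y.
Proof.
rewrite {1}/dot mulr_suml; apply: eq_bigr => i _.
rewrite /dot mulr_sumr; apply: eq_bigr => j _.
transitivity (\sum_k (i == k)%:R * (x 0 i * x 0 k * (x 0 j * y 0 j))).
  by apply: eq_bigr => k _; rewrite /cube /tr13; ring.
exact: sum_delta.
Qed.

Let tprod_cube23 x y : tprod (cube x) (tr23 y) = dot x x * dot x y.
Proof.
rewrite mulrC {1}/dot mulr_suml; apply: eq_bigr => i _.
rewrite /dot mulr_sumr; apply: eq_bigr => j _.
transitivity (\sum_k (j == k)%:R * (x 0 i * y 0 i * (x 0 j * x 0 k))).
  by apply: eq_bigr => k _; rewrite /cube /tr23; ring.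
exact: sum_delta.
Qed.

Let tprod_12_12 x y : tprod (tr12 x) (tr12 y) = n%:R * dot x y.
Proof.
rewrite sum_cst; apply: eq_bigr => i _.
transitivity (\sum_j (i == j)%:R * ((i == j)%:R * dot x y)); last first.
  by rewrite sum_delta eqxx mul1r.
apply: eq_bigr => j _; rewrite /dot !mulr_sumr; apply: eq_bigr => k _.
by rewrite /tr12; ring.
Qed.

Let tprod_13_13 x y : tprod (tr13 x) (tr13 y) = n%:R * dot x y.
Proof.
rewrite sum_cst; apply: eq_bigr => i _.
apply: eq_bigr => j _.
transitivity (\sum_k (i == k)%:R * ((i == k)%:R * (x 0 j * y 0 j))).
  by apply: eq_bigr => k _; rewrite /tr13; ring.
by rewrite sum_delta eqxx mul1r.
Qed.

Let tprod_23_23 x y : tprod (tr23 x) (tr23 y) = n%:R * dot x y.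
Proof.
rewrite /dot mulr_sumr; apply: eq_bigr => i _.
rewrite sum_cst; apply: eq_bigr => j _.
transitivity (\sum_k (j == k)%:R * ((j == k)%:R * (x 0 i * y 0 i))).
  by apply: eq_bigr => k _; rewrite /tr23; ring.
by rewrite sum_delta eqxx mul1r.
Qed.

Let tprod_12_13 x y : tprod (tr12 x) (tr13 y) = dot x y.
Proof.
apply: eq_bigr => i _.
transitivity (\sum_j (i == j)%:R * (x 0 i * y 0 j)); last exact: sum_delta.
apply: eq_bigr => j _.
transitivity (\sum_k (i == k)%:R * ((i == j)%:R * (x 0 k * y 0 j))).
  by apply: eq_bigr => k _; rewrite /tr12 /tr13; ring.
exact: sum_delta.
Qed.

Let tprod_12_23 x y : tprod (tr12 x) (tr23 y) = dot x y.
Proof.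
apply: eq_bigr => i _.
transitivity (\sum_j (i == j)%:R * (x 0 j * y 0 i)); last exact: sum_delta.
apply: eq_bigr => j _.
transitivity (\sum_k (j == k)%:R * ((i == j)%:R * (x 0 k * y 0 i))).
  by apply: eq_bigr => k _; rewrite /tr12 /tr23; ring.
exact: sum_delta.
Qed.

Let tprod_13_23 x y : tprod (tr13 x) (tr23 y) = dot x y.
Proof.
apply: eq_bigr => i _.
transitivity (\sum_j (i == j)%:R * (x 0 j * y 0 i)); last exact: sum_delta.
apply: eq_bigr => j _.
transitivity (\sum_k (j == k)%:R * ((i == k)%:R * (x 0 j * y 0 i))).
  by apply: eq_bigr => k _; rewrite /tr13 /tr23; ring.
exact: sum_delta.
Qed.

Let tprodC T U : tprod T U = tprod U T.
Proof.
by do 3!(apply: eq_bigr => ? _); rewrite mulrC.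
Qed.

(** The two-coefficient form matches the nesting of [harm3], whose unit coefficients let rewriting
    expand the whole pairing. *)
Let tprodDl T T' U a b :
  tprod (fun i j k => a * T i j k + b * T' i j k) U =
  a * tprod T U + b * tprod T' U.
Proof.
rewrite /tprod !mulr_sumr -big_split; apply: eq_bigr => i _ /=.
rewrite !mulr_sumr -big_split; apply: eq_bigr => j _ /=.
rewrite !mulr_sumr -big_split; apply: eq_bigr => k _ /=.
by ring.
Qed.

Let tprodDr T U U' a b :
  tprod T (fun i j k => a * U i j k + b * U' i j k) =
  a * tprod T U + b * tprod T U'.
Proof. by rewrite tprodC tprodDl !(tprodC _ T). Qed.

Lemma dotC x y : dot x y = dot y x.
Proof. by apply: eq_bigr => i _; rewrite mulrC. Qed.

(* The traceless part of [x (x) x (x) x]. *)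
Let harm3 x i j k : R := 1 * cube x i j k + - (n%:R + 2)^-1 *
  (1 * tr12 x i j k + 1 * (1 * tr13 x i j k + 1 * tr23 x i j k)).

(** With [t = dot x y], the cubes pair to [t ^+ 3], each of the six cube-trace pairs to [t], and the
    nine trace-trace pairs to [(3 n + 6) t] in total. The result is the degree-three Gegenbauer
    polynomial up to scale. *)
Lemma sum3_kernel x y : usphere x -> usphere y ->
  \sum_(p : 'I_n * 'I_n * 'I_n)
    harm3 x p.1.1 p.1.2 p.2 * harm3 y p.1.1 p.1.2 p.2
  = dot x y ^+ 3 - 3 / (n%:R + 2) * dot x y.
Proof.
move=> /usphere_dot x1 /usphere_dot y1.
rewrite -(pair_bigA _ (fun p k => harm3 x p.1 p.2 k * harm3 y p.1 p.2 k))/=.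
rewrite -(pair_bigA _ (fun i j => \sum_k harm3 x i j k * harm3 y i j k))/=.
have n0R : n%:R + 2 != 0 :> R by rewrite lt0r_neq0// ltr_wpDl.
rewrite -/(tprod (harm3 x) (harm3 y)) /harm3 !(tprodDl, tprodDr).
rewrite (tprodC (tr12 x) (cube y)) (tprodC (tr13 x) (cube y)).
rewrite (tprodC (tr23 x) (cube y)) (tprodC (tr13 x) (tr12 y)).
rewrite (tprodC (tr23 x) (tr12 y)) (tprodC (tr23 x) (tr13 y)).
rewrite tprod_cube !tprod_cube12 !tprod_cube13 !tprod_cube23.
rewrite tprod_12_12 tprod_13_13 tprod_23_23.
rewrite !tprod_12_13 !tprod_12_23 !tprod_13_23 (dotC y x) x1 y1; field.
exact: n0R.
Qed.

Lemma sum_dot2_ge X : (0 < n)%N -> (forall x, x \in X -> usphere x) ->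
  (size X)%:R ^+ 2 / n%:R <= \sum_(x <- X) \sum_(y <- X) dot x y ^+ 2.
Proof.
move=> n0 X1.
have := sum_kernel_ge0 _ (fun x (p : 'I_n * 'I_n) =>
  x 0 p.1 * x 0 p.2 - (p.1 == p.2)%:R / n%:R) X.
rewrite (_ : (\sum_(x <- X) _)%R =
  \sum_(x <- X) \sum_(y <- X) (dot x y ^+ 2 - n%:R^-1)); last first.
  apply: eq_big_seq => x xX; apply: eq_big_seq => y yX.
  by apply: sum2_kernel => //; exact: X1.
under eq_bigr do rewrite sumrB big_const_seq iter_addr_0 count_predT.
rewrite sumrB big_const_seq iter_addr_0 count_predT subr_ge0.
by rewrite -mulrnA -(mulr_natl n%:R^-1) natrM expr2.
Qed.

Lemma sum_dot3_ge0 X : (forall x, x \in X -> usphere x) ->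
  0 <= \sum_(x <- X) \sum_(y <- X)
         (dot x y ^+ 3 - 3 / (n%:R + 2) * dot x y).
Proof.
move=> X1; have := sum_kernel_ge0 _ (fun x (p : 'I_n * 'I_n * 'I_n) =>
  harm3 x p.1.1 p.1.2 p.2) X.
congr (0 <= _); apply: eq_big_seq => x xX; apply: eq_big_seq => y yX.
by rewrite sum3_kernel//; exact: X1.
Qed.

End Moments.

(** * The linear programming bound on the energy *)

Section LinearProgramming.
Variables (R : realType) (n : nat).
Implicit Types (C : {fset 'rV[R]_n}) (h : R -> R).

(** The diagonal of the energy vanishes because [L 1 = 0]. Removing [h 1] there leaves a termwise
    comparison in which [h] must dominate [L] off the diagonal only. *)
Lemma energyL_le (h : R -> R) C : ([set` C] `<=` @usphere R n)%classic ->
  (forall x y, x \in C -> y \in C -> x != y -> L (dot x y) <= h (dot x y)) ->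
  energyL C <= \sum_(x <- C) \sum_(y <- C) h (dot x y) - #|` C|%:R * h 1.
Proof.
move=> C1 hL.
have -> : #|` C|%:R * h 1 =
    \sum_(x <- C) \sum_(y <- C) (if y == x then h 1 else 0).
  rewrite mulr_natl -(count_predT C) -iter_addr_0 -big_const_seq.
  apply: eq_big_seq => x xC; rewrite (big_fsetD1 x)//= eqxx big1_fset ?addr0//.
  by move=> y; rewrite !inE => /andP[/negPf ->].
rewrite -sumrB /energyL big_seq [leRHS]big_seq ler_sum// => x xC.
rewrite -sumrB big_seq [leRHS]big_seq ler_sum// => y yC.
case: eqVneq => [->|yx]; last by rewrite subr0 hL// eq_sym.
by rewrite (usphere_dot _ _ _ (C1 _ xC)) subrr /L subrr mulr0 sqrtr0 oppr0.
Qed.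

Lemma sup_energyL_le (N : nat) (s b : R) :
  (forall C, spherical_code N s C -> energyL C <= b) ->
  (sup_energyL n N s <= b%:E)%E.
Proof. by move=> hb; apply: ub_ereal_sup => _ [C CC <-]; rewrite lee_fin hb. Qed.

(* The cubic has no component on the linear harmonic, so that only the
   second and third moments of the code matter. *)
Lemma cubic_bound (N : nat) (s c0 c2 c3 : R) (h : R -> R) :
  (0 < n)%N -> c2 <= 0 -> c3 <= 0 ->
  (forall t, h t = c0 + c2 * t ^+ 2 + c3 * (t ^+ 3 - 3 / (n%:R + 2) * t)) ->
  (forall t, -1 <= t <= s -> L t <= h t) ->
  (sup_energyL n N s <= (N%:R ^+ 2 * (c0 + c2 / n%:R) - N%:R * h 1)%:E)%E.
Proof.
move=> n0 c2_le0 c3_le0 hE hL; apply: sup_energyL_le => C [C1 CN Cs].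
have X1 x : x \in (C : seq _) -> usphere x by exact: C1.
apply: (le_trans (energyL_le h _ C1 _)) => [x y xC yC xy|].
  by rewrite hL// Cs// dot_geN1//; exact: C1.
rewrite CN lerD2r.
under eq_bigr do under eq_bigr do rewrite hE.
under eq_bigr do
  rewrite !big_split/= big_const_seq iter_addr_0 count_predT -!mulr_sumr.
rewrite !big_split/= big_const_seq iter_addr_0 count_predT -!mulr_sumr.
have := sum_dot2_ge _ _ C n0 X1; have := sum_dot3_ge0 _ _ C X1.
rewrite [size C]CN => /(ler_wnM2l c3_le0); rewrite mulr0 => h3.
move=> /(ler_wnM2l c2_le0) h2.
by rewrite -mulrnA -(mulr_natl c0) natrM -expr2; lra.
Qed.

End LinearProgramming.

(** * Identities and inequalities for the interpolating polynomials *)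

Section Scalars.
Variable R : realType.
Implicit Types n N s : R.

(* The left-hand side is the linear Gegenbauer coefficient of
   [(t - alpha) ^+ 2 * (t - s)] for [alpha = 1 - A]. *)
Lemma linear_coef_cubic n s (A := ((n + 1) * s + 2) / (1 + n * s)) :
  n + 2 != 0 -> 1 + n * s != 0 ->
  3 / (n + 2) + (1 - A) ^+ 2 + 2 * (1 - A) * s =
  - coefC4 n s / ((n + 2) * (1 + n * s) ^+ 2).
Proof.
by move=> n2 p0; rewrite /A /coefC4; field; rewrite n2 p0.
Qed.

(* [w] stands for [a * b], and [k] for [1 / (a + b) ^+ 2]. *)
Lemma tau3_algebra n N s w
    (A := ((n + 1) * s + 2) / (1 + n * s)) (B := 1 - s)
    (q := 1 + 2 * s + n * s ^+ 2)
    (k := (1 + n * s) ^+ 2 * (A + B - 2 * w) / q ^+ 2)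
    (f1 := 3 / (n + 2) + (1 - A) ^+ 2 + 2 * (1 - A) * s)
    (lam := k * (3 * A + 2 * w + B - 2) / f1)
    (c0 := lam * (1 - A) ^+ 2 * s
           + k * (1 - (3 * A + 2 * w + B) - A * (2 * w + B)))
    (c2 := lam * (2 * (1 - A) + s) + k) :
  n != 0 -> n + 2 != 0 -> 1 + n * s != 0 -> q != 0 -> B != 0 ->
  coefC4 n s != 0 -> w ^+ 2 = A * B ->
  N ^+ 2 * (c0 + c2 / n) - N * (- lam * A ^+ 2 * B - k * A * (2 * w + B)) =
  - (N * (2 * N * q * coefC4 n s * ((1 + n * s) ^+ 2 * B + (n - 1) * w)
       - coefA5 n N s * (B * (1 + n * s) * coefA4 n s + coefB4 n s * w))
     / (n * B * q ^+ 2 * coefC4 n s)).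
Proof.
move=> n0 n2 p0 q0 B0 C0 w2.
(* Reducing [k * w] by [w ^+ 2 = A * B] makes both sides affine in [w], so [field] can treat [w] as
   free. *)
set kw := (1 + n * s) ^+ 2 * ((A + B) * w - 2 * (A * B)) / q ^+ 2.
have kwE : k * w = kw by rewrite /kw -w2 /k; field.
have lamE : lam = - (k * (3 * A + B - 2) + 2 * kw)
     * ((n + 2) * (1 + n * s) ^+ 2) / coefC4 n s.
  rewrite /lam /f1 linear_coef_cubic// -kwE; field.
  by rewrite n2 p0 C0.
have c0E : c0 = lam * (1 - A) ^+ 2 * s
           + k * (1 - (3 * A + B) - A * B) - 2 * kw * (1 + A).
  by rewrite /c0 -kwE; ring.
have h1E : - lam * A ^+ 2 * B - k * A * (2 * w + B) =
   - lam * A ^+ 2 * B - k * A * B - 2 * A * kw by rewrite -kwE; ring.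
rewrite h1E c0E /c2 lamE {lamE c0E h1E kwE c0 c2 lam f1 w2} /kw /k.
move: C0; rewrite /coefA4 /coefB4 /coefA5 /coefC4 => C0.
rewrite /A /B /q in B0 q0 *; field.
by rewrite ?n0 ?n2 ?p0 ?q0 ?B0 ?C0.
Qed.

Lemma le_L (t s : R) : t <= s -> L t <= L s.
Proof. by move=> ts; rewrite /L lerN2 ler_wsqrtr//; lra. Qed.

(** In the distance [u = sqrt (2 (1 - t))] the error is a quartic with roots [r] (at [t = s]) and
    [2] (at [t = -1]); the remaining quadratic factor is nonnegative for [u >= 0]. *)
Lemma L_le_even_quadratic (r t : R) : 0 < r ->
  -1 <= t <= 1 - r ^+ 2 / 2 ->
  L t <= - r - 4 / (r ^+ 2 * (2 + r)) * (t ^+ 2 - (1 - r ^+ 2 / 2) ^+ 2).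
Proof.
move=> r0 /andP[t1 ts]; rewrite /L; set u := Num.sqrt _.
have u2 : u ^+ 2 = 2 * (1 - t) by rewrite sqr_sqrtr//; nra.
have u0 : 0 <= u by exact: sqrtr_ge0.
have ru : r <= u by nra.
have ule2 : u <= 2 by nra.
have tE : t = 1 - u ^+ 2 / 2 by rewrite u2; lra.
rewrite -subr_ge0 tE.
rewrite (_ : _ - _ = (u - r) * (2 - u) * (u ^+ 2 + (2 + r) * u + r ^+ 2 + 2 * r)
  / (r ^+ 2 * (2 + r))); last first.
  by field; rewrite !gt_eqF//; lra.
by apply: divr_ge0; [apply: mulr_ge0; [apply: mulr_ge0; lra|nra]
  | apply: mulr_ge0; [exact: sqr_ge0|lra]].
Qed.

(** With [r = sqrt (2 (1 - s))] as parameter the identity is rational. The factorization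
    [4 (1 - s^2) = r^2 (2 + r) (2 - r)] accounts for the conditions on [r]. *)
Lemma tau2_algebra (n N r : R) (s := 1 - r ^+ 2 / 2)
    (c2 := - (4 / (r ^+ 2 * (2 + r)))) :
  n != 0 -> r != 0 -> 2 + r != 0 -> 2 - r != 0 ->
  N ^+ 2 * (- r - c2 * s ^+ 2 + c2 / n) - N * (- r + c2 * (1 - s ^+ 2)) =
  - (N * (2 * N * (1 - n * s ^+ 2) - 2 * n * (1 - s ^+ 2) + N * (n - 1) * r)
     / (n * (1 - s ^+ 2))).
Proof.
move=> n0 r0 r2 r2'; rewrite /c2 /s; field.
rewrite n0 r0 r2/=.
rewrite (_ : _ - _ = r ^+ 2 * ((2 + r) * (2 - r))); last by ring.
by rewrite !mulf_neq0.
Qed.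

(* With [u = sqrt (1 - t)], the error of the quadratic interpolating [L] at
   [1 - b ^+ 2] and doubly at [1 - a ^+ 2] is a quartic in [u] without cubic
   term, so its fourth root is [- (2 * a + b)]. *)
Lemma L_le_interpolant (a b t : R) (k := Num.sqrt 2 / (2 * a * (a + b) ^+ 2)) :
  0 < a -> 0 <= b -> t <= 1 - b ^+ 2 ->
  L t <= k * ((1 - t) ^+ 2 - (3 * a ^+ 2 + 2 * a * b + b ^+ 2) * (1 - t)
              - a ^+ 2 * b * (2 * a + b)).
Proof.
move=> a0 b0 tb; rewrite /L sqrtrM//; set u := Num.sqrt (1 - t).
have u2 : 1 - t = u ^+ 2 by rewrite sqr_sqrtr//; nra.
have u0 : 0 <= u by exact: sqrtr_ge0.
have bu : b <= u by nra.
have ab0 : 0 < a + b by lra.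
(* The quartic [(u - a)^2 (u - b) (u + 2 a + b)] has linear coefficient [2 a (a + b)^2]; [k] scales
   it to [sqrt 2]. *)
have kE : Num.sqrt 2 = k * (2 * a * (a + b) ^+ 2).
  by rewrite /k; field; rewrite !gt_eqF.
have k0 : 0 <= k by rewrite divr_ge0 ?sqrtr_ge0 ?mulr_ge0 ?sqr_ge0 ?ltW.
rewrite -subr_ge0 u2 kE.
rewrite (_ : _ - _ = k * ((u - a) ^+ 2 * (u - b) * (u + (2 * a + b)))); last ring.
apply: mulr_ge0 => //; apply: mulr_ge0; last lra.
by apply: mulr_ge0; [exact: sqr_ge0|lra].
Qed.

(** [- coefC4 n s] is the sum of [2 n s (1 - (n + 2) s^2 - 2 s)], [(n - 2) (n + 1) s^2], [4 n s] and
    [n + 5]. The sign makes the divisor of [lam] positive. *)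
Lemma coefC4_lt0 (n s : R) : 2 <= n -> 0 <= s ->
  (n + 2) * s ^+ 2 + 2 * s <= 1 -> coefC4 n s < 0.
Proof.
move=> n2 s0 hs; rewrite /coefC4.
have : 0 <= 2 * n * s * (1 - (n + 2) * s ^+ 2 - 2 * s).
  by rewrite !mulr_ge0//; lra.
have : 0 <= (n - 2) * (n + 1) * s ^+ 2.
  by apply: mulr_ge0; [apply: mulr_ge0; lra|exact: sqr_ge0].
have : 0 <= n * s by rewrite mulr_ge0//; lra.
lra.
Qed.

(** Here [be] is [- alpha]. This is the condition for a nonpositive [t^2] coefficient of [h], with
    [m - 2] replaced by its lower bound [4 + 3 be - 3 s]. *)
Lemma quadratic_coef_le0 (n s be : R) : 2 <= n -> 0 <= s ->
  (n + 2) * s ^+ 2 + 2 * s <= 1 -> be * (1 + n * s) = 1 + s ->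
  3 / (n + 2) + be ^+ 2 - 2 * be * s <= (4 + 3 * be - 3 * s) * (2 * be - s).
Proof.
move=> n2 s0 hs hbe.
have s3 : s <= 1 / 3 by nra.
have ns0 : 0 <= n * s by rewrite mulr_ge0//; lra.
have bes : s <= be by nra.
(* Since [2 be - s >= be], the right-hand side is at least [be (4 + 3 (be - s))], which leaves room
   for the constant [5 / 3]. *)
have hn : 3 / (n + 2) <= 5 / 3 * be.
  rewrite ler_pdivrMr; last lra.
  nra.
nra.
Qed.
End Scalars.

(** * The three bounds for codes, from explicit choices of [h] *)

Section Bounds.
Variables (R : realType) (n N : nat).
Hypothesis n2 : (2 <= n)%N.
Let n0 : (0 < n)%N. Proof. exact: leq_trans n2. Qed.
Let n2R : 2 <= n%:R :> R. Proof. by rewrite ler_nat. Qed.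

Lemma sup_energyL_le_tau1 (s : R) :
  (sup_energyL n N s <= (- tau1 n%:R N%:R s)%:E)%E.
Proof.
apply: (le_trans (@cubic_bound R n N s (L s) 0 0 (fun=> L s) n0 _ _ _ _)) => //.
- by move=> t; ring.
- by move=> t /andP[_ /le_L].
- by rewrite lee_fin mul0r addr0 /tau1 /L; lra.
Qed.

Lemma sup_energyL_le_tau2 (s : R) : -1 < s <= 0 ->
  (sup_energyL n N s <= (- tau2 n%:R N%:R s)%:E)%E.
Proof.
move=> /andP[sN1 s0].
pose r := Num.sqrt (2 * (1 - s)).
have r2 : r ^+ 2 = 2 * (1 - s) by rewrite sqr_sqrtr//; lra.
have r0 : 0 < r by rewrite sqrtr_gt0; lra.
have r_lt2 : r < 2 by nra.
have sE : s = 1 - r ^+ 2 / 2 by rewrite r2; lra.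
pose c2 := - (4 / (r ^+ 2 * (2 + r))).
have c2_le0 : c2 <= 0.
  by rewrite oppr_le0 divr_ge0 ?mulr_ge0 ?sqr_ge0 ?addr_ge0 ?ltW.
have hL t : -1 <= t <= s -> L t <= - r - c2 * s ^+ 2 + c2 * t ^+ 2.
  rewrite {1}sE => /(L_le_even_quadratic _ _ _ r0) /le_trans; apply.
  by rewrite -sE /c2; lra.
apply: (le_trans
  (@cubic_bound R n N s (- r - c2 * s ^+ 2) c2 0 _ n0 c2_le0 _ _ hL)) => //.
  by move=> t; ring.
rewrite lee_fin /tau2 -/r.
have nR0 : n%:R != 0 :> R by rewrite pnatr_eq0 -lt0n.
have := @tau2_algebra R n%:R N%:R r nR0 _ _ _.
rewrite -sE -/c2 => <-.
  by rewrite le_eqVlt; apply/orP; left; apply/eqP; ring.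
all: rewrite gt_eqF//; lra.
Qed.

Lemma sup_energyL_le_tau3 (s : R) : 0 <= s ->
  (n%:R + 2) * s ^+ 2 + 2 * s <= 1 ->
  (sup_energyL n N s <= (- tau3 n%:R N%:R s)%:E)%E.
Proof.
move=> s0 hs.
have s_lt1 : s < 1.
  have : 0 <= (n%:R + 2) * s ^+ 2 by rewrite mulr_ge0 ?sqr_ge0 ?addr_ge0.
  lra.
have p0 : 0 < 1 + n%:R * s by rewrite ltr_wpDr// mulr_ge0.
(* [A] is [1 - alpha], the value of [1 - t] at the double node. *)
pose A := ((n%:R + 1) * s + 2) / (1 + n%:R * s).
have AE : A = 1 + (1 + s) / (1 + n%:R * s).
  by rewrite /A; field; rewrite gt_eqF.
have be0 : 0 < (1 + s) / (1 + n%:R * s) by rewrite divr_gt0//; lra.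
pose a := Num.sqrt A; pose b := Num.sqrt (1 - s).
have a2 : a ^+ 2 = A by rewrite sqr_sqrtr//; lra.
have b2 : b ^+ 2 = 1 - s by rewrite sqr_sqrtr//; lra.
have a0 : 0 < a by rewrite sqrtr_gt0; lra.
have b0 : 0 < b by rewrite sqrtr_gt0; lra.
have ba : b <= a by rewrite ler_wsqrtr//; lra.
have C0 := coefC4_lt0 _ _ _ n2R s0 hs.
pose q := 1 + 2 * s + n%:R * s ^+ 2.
have q0 : 0 < q by rewrite /q ltr_wpDr ?mulr_ge0 ?sqr_ge0//; lra.
have qE : q = (1 + n%:R * s) * (A - (1 - s)).
  by rewrite /A /q; field; rewrite gt_eqF.
have ab0 : 0 < a + b by lra.
(* [q] is [(1 + n s) (a^2 - b^2)], so its positivity separates [a] from [b]; rationalizing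
   [1 / (a + b)^2] below relies on this. *)
have abN0 : a - b != 0.
  apply/eqP => ab; have : A - (1 - s) = 0 by rewrite -a2 -b2; nra.
  by apply/eqP; apply: contraTneq q0 => AB; rewrite qE AB mulr0 ltxx.
pose k := Num.sqrt 2 / (2 * a * (a + b) ^+ 2).
have k0 : 0 < k by rewrite divr_gt0 ?sqrtr_gt0 ?mulr_gt0 ?exprn_gt0.
pose f1 := 3 / (n%:R + 2) + (1 - A) ^+ 2 + 2 * (1 - A) * s.
have nR20 : 0 < n%:R + 2 :> R by rewrite ltr_wpDl.
have f1_gt0 : 0 < f1.
  rewrite /f1 linear_coef_cubic ?lt0r_neq0//.
  by rewrite divr_gt0 ?oppr_gt0// pmulr_rgt0 ?exprn_gt0.
pose m := 3 * a ^+ 2 + 2 * a * b + b ^+ 2.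
(* Using [a b >= b^2] trades the irrational [m] for a rational lower bound. *)
have m2 : 6 + 3 * (A - 1) - 3 * s <= m.
  have : b * b <= a * b by rewrite ler_pM2r.
  by rewrite -expr2 /m a2 b2; lra.
(* [k * (m - 2)] is the linear coefficient of [g], which [- lam * f1] has to cancel. *)
pose lam := k * (m - 2) / f1.
have lam0 : 0 <= lam.
  have m_ge2 : 0 <= m - 2 by lra.
  exact: divr_ge0 (mulr_ge0 (ltW k0) m_ge2) (ltW f1_gt0).
pose c2 := lam * (2 * (1 - A) + s) + k.
have c2_le0 : c2 <= 0.
  have -> : c2 = k * ((m - 2) * (2 * (1 - A) + s) + f1) / f1.
    by rewrite /c2 /lam; field; rewrite gt_eqF.
  rewrite pmulr_lle0 ?invr_gt0// pmulr_rle0//.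
  have hbe : (A - 1) * (1 + n%:R * s) = 1 + s.
    by rewrite AE; field; rewrite gt_eqF.
  have := quadratic_coef_le0 _ _ _ _ n2R s0 hs hbe.
  have : 0 <= n%:R * s by rewrite mulr_ge0.
  have bes : s <= A - 1 by nra.
  have : 0 <= (m - (6 + 3 * (A - 1) - 3 * s)) * (2 * (A - 1) - s).
    by rewrite mulr_ge0//; lra.
  by rewrite /f1; lra.
pose c0 := lam * (1 - A) ^+ 2 * s + k * (1 - m - A * (2 * (a * b) + b ^+ 2)).
pose g t := k * ((1 - t) ^+ 2 - m * (1 - t) - a ^+ 2 * b * (2 * a + b)).
pose h t := - lam * (t - (1 - A)) ^+ 2 * (t - s) + g t.
have hE t : h t = c0 + c2 * t ^+ 2
    + (- lam) * (t ^+ 3 - 3 / (n%:R + 2) * t).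
  have lamE : k * (m - 2) = lam * f1.
    by rewrite /lam; field; rewrite gt_eqF.
  have -> : h t = - lam * (t - (1 - A)) ^+ 2 * (t - s) + k * (m - 2) * t
      + k * (t ^+ 2 + 1 - m - A * (2 * (a * b) + b ^+ 2)).
    by rewrite /h /g -a2; ring.
  by rewrite lamE /f1 /c0 /c2; ring.
have hL t : -1 <= t <= s -> L t <= h t.
  move=> /andP[_ ts]; apply: (@le_trans _ _ (g t)).
    by apply: L_le_interpolant; [|exact: ltW|rewrite b2; lra].
  rewrite lerDr (_ : _ * _ = lam * ((t - (1 - A)) ^+ 2 * (s - t))); last ring.
  by apply: mulr_ge0 => //; apply: mulr_ge0; [exact: sqr_ge0|rewrite subr_ge0].
have lamN0 : - lam <= 0 by rewrite oppr_le0.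
apply: (le_trans (@cubic_bound R n N s c0 c2 (- lam) h n0 c2_le0 lamN0 hE hL)).
rewrite lee_fin le_eqVlt; apply/orP; left; apply/eqP.
have C0' : coefC4 n%:R s != 0 by rewrite lt_eqF.
have B5E : coefB5 n%:R s = a ^+ 2 by rewrite a2.
have A6E : Num.sqrt (coefA6 n%:R s)
    = b * ((1 + n%:R * s) ^+ 2 * b + (n%:R - 1) * a).
  have Ap : (n%:R + 1) * s + 2 = a ^+ 2 * (1 + n%:R * s).
    by rewrite a2 /A; field; rewrite gt_eqF.
  have B2E : coefB2 n%:R s = (n%:R - 1) * ((1 + n%:R * s) * a * b).
    rewrite /coefB2 Ap -b2; congr (_ * _).
    rewrite (_ : b ^+ 2 * _ * _ = ((1 + n%:R * s) * a * b) ^+ 2); last ring.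
    by rewrite sqrtr_sqr ger0_norm// !mulr_ge0// ltW.
  have -> : coefA6 n%:R s =
      (b * ((1 + n%:R * s) ^+ 2 * b + (n%:R - 1) * a)) ^+ 2.
    by rewrite /coefA6 B2E /coefA2 Ap -b2; field; rewrite gt_eqF.
  have n1 : 0 <= n%:R - 1 :> R by rewrite subr_ge0 ler1n.
  rewrite sqrtr_sqr ger0_norm//; apply: (mulr_ge0 (ltW b0)).
  exact: addr_ge0 (mulr_ge0 (sqr_ge0 _) (ltW b0)) (mulr_ge0 n1 (ltW a0)).
have w2 : (a * b) ^+ 2 = A * (1 - s) by rewrite exprMn a2 b2.
have sqrtB5 : Num.sqrt ((1 - s) * coefB5 n%:R s) = a * b.
  rewrite B5E -b2 -exprMn sqrtr_sqr ger0_norm 1?mulrC//.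
  by rewrite mulr_ge0 ?(ltW a0) ?(ltW b0).
have sqrt2B5 : Num.sqrt (2 * coefB5 n%:R s) = Num.sqrt 2 * a.
  by rewrite B5E sqrtrM// sqrtr_sqr gtr0_norm.
have sqrt2 : Num.sqrt 2 ^+ 2 = 2 :> R by rewrite sqr_sqrtr.
have sqrt2_gt0 : 0 < Num.sqrt 2 :> R by rewrite sqrtr_gt0.
have nR0 : n%:R != 0 :> R by rewrite pnatr_eq0 -lt0n.
have Bn0 : 1 - s != 0 by rewrite gt_eqF// subr_gt0.
(* This is [1 / (a + b)^2] rationalized as [(a - b)^2 / (a^2 - b^2)^2]. *)
pose k1 := (1 + n%:R * s) ^+ 2 * (A + (1 - s) - 2 * (a * b)) / q ^+ 2.
have kE : k = k1 / (Num.sqrt 2 * a).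
  rewrite /k /k1 qE -a2 -b2 -[X in _ / (X * a * _)]sqrt2; field.
  rewrite subr_sqr mulf_neq0 ?(lt0r_neq0 a0) ?(lt0r_neq0 ab0) ?(lt0r_neq0 p0)//.
  by rewrite (lt0r_neq0 sqrt2_gt0).
have mE : m = 3 * A + 2 * (a * b) + (1 - s) by rewrite /m a2 b2; ring.
have h1E : h 1 = - lam * A ^+ 2 * (1 - s) - k * A * (2 * (a * b) + (1 - s)).
  by rewrite /h /g -a2 -b2; ring.
have := @tau3_algebra R n%:R N%:R s (a * b) nR0 (lt0r_neq0 nR20) (lt0r_neq0 p0)
  (lt0r_neq0 q0) Bn0 C0' w2.
rewrite -/A -/q -/f1 -/k1.
rewrite /tau3 A6E sqrtB5 sqrt2B5 -/q.
set rhs := (X in _ = - X) => e.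
move: e; set lhs := (X in X = _ -> _) => e.
(* [lam], [c0], [c2] and [h 1] are all linear in [k], so passing from [k] to [k1] extracts the
   single factor [1 / (sqrt 2 a)]. *)
transitivity (lhs / (Num.sqrt 2 * a)).
  rewrite h1E /c0 /c2 /lam mE b2 kE /lhs; field.
  by rewrite nR0 ?gt_eqF.
rewrite e /rhs -b2; field.
by rewrite C0' (lt0r_neq0 a0) (lt0r_neq0 b0) (lt0r_neq0 q0)
  (lt0r_neq0 sqrt2_gt0) nR0.
Qed.

End Bounds.

Theorem proposition5p2 (R : realType) (n N : nat) (s : R)
    (hn : (2 <= n)%N) (hN : (2 <= N)%N) :
  [/\ (2 <= N <= n + 1)%N ->
      - (1 / (N%:R - 1)) <= s <= - (1 / n%:R) ->
      (sup_energyL n N s <= (- tau1 n%:R N%:R s)%:E)%E,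
      (n + 1 <= N <= 2 * n)%N ->
      (N%:R - 2 * n%:R) / (n%:R * (N%:R - 2)) <= s <= 0 ->
      (sup_energyL n N s <= (- tau2 n%:R N%:R s)%:E)%E &
      (2 * n <= N <= n * (n + 3) %/ 2)%N ->
      (Num.sqrt (n%:R ^+ 2 * (n%:R - 1) ^+ 2
                 + 4 * n%:R * (N%:R - n%:R - 1) * (N%:R - 2 * n%:R))
       - n%:R * (n%:R - 1)) / (2 * n%:R * (N%:R - n%:R - 1))
      <= s <= (Num.sqrt (n%:R + 3) - 1) / (n%:R + 2) ->
      (sup_energyL n N s <= (- tau3 n%:R N%:R s)%:E)%E].
Proof.
have n2 : 2 <= n%:R :> R by rewrite ler_nat.
split=> [_ _|/andP[nN _] /andP[ls s0]|/andP[nN _] /andP[ls sl]].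
- exact: sup_energyL_le_tau1.
- apply: sup_energyL_le_tau2 => //; rewrite s0 andbT.
  have nNR : n%:R + 1 <= N%:R :> R by rewrite natr1 ler_nat -addn1.
  apply: lt_le_trans ls.
  rewrite ltr_pdivlMr; last by apply: mulr_gt0; lra.
  (* What remains is [4 n < (n + 1) N], which follows from [N >= n + 1] and [(n - 1)^2 > 0]. *)
  nra.
- have nNR : 2 * n%:R <= N%:R :> R by rewrite -natrM ler_nat.
  (* For [N >= 2 n] the radicand is at least [(n (n - 1))^2], so the lower endpoint is
     nonnegative. *)
  have s0 : 0 <= s.
    apply: le_trans ls; apply: divr_ge0; last by apply: mulr_ge0; lra.
    have nn0 : 0 <= n%:R * (n%:R - 1) :> R by apply: mulr_ge0; lra.
    rewrite subr_ge0 -[leLHS]ger0_norm// -sqrtr_sqr ler_wsqrtr// exprMn lerDl.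
    by apply: mulr_ge0; [apply: mulr_ge0; lra|lra].
  apply: sup_energyL_le_tau3 => //.
  have n20 : 0 < n%:R + 2 :> R by lra.
  move: sl; rewrite ler_pdivlMr// => sl.
  set r := Num.sqrt (n%:R + 3) in sl.
  have r2 : r ^+ 2 = n%:R + 3 by rewrite sqr_sqrtr//; lra.
  (* The upper endpoint is the positive root of [(n + 2) s^2 + 2 s = 1]; multiplying by [n + 2]
     completes the square. *)
  have sr : (s * (n%:R + 2) + 1) ^+ 2 <= r ^+ 2.
    have : 0 <= s * (n%:R + 2) by apply: mulr_ge0 => //; lra.
    by move=> ?; rewrite ler_sqr ?nnegrE ?sqrtr_ge0//; lra.
  rewrite -(ler_pM2l n20); lra.
Qed.
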